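(* Let $F^\bullet$ be a bounded sequence of based finite-rank free $R_n$-modules with homogeneous basis indexed by $I$, let $(x_i)_{i\in I}\in(\mathbb{R}^n)^I$ be a choice of points, and let $X(F^\bullet)$ be the associated semi-simplicial complex over $T^n$. If the $x_i$ are distinct modulo $\mathbb{Z}^n$, then for any $i,j\in I$ we have $$E_{ij}=\{m\in\mathbb{Z}^n \;|\; [x_j,x_i+m]\bmod\mathbb{Z}^n\in X(F^\bullet)_1\}.$$ In particular, the discrete information in $F^\bullet$ can be recovered up to equivalence from $X(F^\bullet)$ and the function $\deg:X(F^\bullet)_0\to\mathbb{Z}$.
   Context: $R_n:=\mathbb{C}[z_1^{\pm1},\dots,z_n^{\pm1}]$, $T^n=\mathbb{R}^n/\mathbb{Z}^n$, $\pi:\mathbb{R}^n\to T^n$ is the projection, and $z^m=z_1^{m_1}\cdots z_n^{m_n}$ for $m\in\mathbb{Z}^n$. Sequences. $F^\bullet=\cdots\to F^k\xrightarrow{d^k}F^{k+1}\to\cdots$ is a bounded sequence of finite-rank free $R_n$-modules and homomorphisms (it is not required that $d^2=0$). It is based: for each $k$ there is a fixed finite set $I_k$ and an isomorphism $F^k\cong R_n^{\oplus I_k}$. $I:=\bigsqcup_k I_k$ and $\deg:I\to\mathbb{Z}$ is $\deg(i)=k$ for $i\in I_k$. It is assumed $F^0\not\cong0$ and $F^k\cong0$ for $k>0$. For $i\in I_{k+1}$, $j\in I_k$, $d^k_{ij}\in R_n$ is the entry in row $i$, column $j$ of the matrix of $d^k$. Exponent sets $E_{ij}\subset\mathbb{Z}^n$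 for $i,j\in I$: (a) if $\deg(i)\le\deg(j)$, $E_{ij}=\emptyset$; (b) if $\deg(i)=\deg(j)+1$, $E_{ij}$ is the set of exponents of $d^{\deg(j)}_{ij}$, i.e. $d^{\deg(j)}_{ij}=\sum_{m\in E_{ij}}c_{ijm}z^m$ with all $c_{ijm}\ne0$; (c) if $\deg(i)=\deg(j)+k$ with $k>1$, then $m\in E_{ij}$ iff $m=\sum_{\ell=1}^k m_\ell$ for some $i_1,\dots,i_{k-1}\in I$ with $\deg(i_\ell)=\deg(j)+\ell$ and some $(m_1,\dots,m_k)\in E_{i_1j}\times E_{i_2i_1}\times\cdots\times E_{i\,i_{k-1}}$. Simplices. For $y_0,\dots,y_k\in\mathbb{R}^n$, $[y_0,\dots,y_k]\bmod\mathbb{Z}^n$ is the map $\Delta^k\to T^n$ obtained by composing the linear map sending the vertices of $\Delta^k$ in order to $y_0,\dots,y_k$ with $\pi$. $X(F^\bullet)=\{X(F^\bullet)_k\}_{k\in\mathbb{N}}$ is defined, given points $x_i\in\mathbb{R}^n$ $(i\in I)$, by $$X(F^\bullet)_k:=\bigcup_{i_0,\dots,i_k\in I}\Big\{\big[x_{i_0},\,x_{i_1}+m_1,\,\dots,\,x_{i_k}+\textstyle\sum_{\ell=1}^k m_\ell\big]\bmod\mathbb{Z}^n \;:\;(m_1,\dots,m_k)\in E_{i_1i_0}\times\cdots\times E_{i_ki_{k-1}}\Big\},$$ with $X(F^\bullet)_0=\{[x_i]\bmod\mathbb{Z}^n\}_{i\in I}$. When the $x_i$ are distinct modulo $\mathbb{Z}^n$,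 $I\cong X(F^\bullet)_0$, and $\deg:X(F^\bullet)_0\to\mathbb{Z}$ is the function corresponding to $\deg:I\to\mathbb{Z}$. Discrete information. The discrete information in $F^\bullet$ consists of the index set $I$, the function $\deg:I\to\mathbb{Z}$, and the function $E:I\times I\to P(\mathbb{Z}^n)$, $(i,j)\mapsto E_{ij}$, where $P(\mathbb{Z}^n)$ is the power set. Two collections of such information are equivalent if they differ by a finite sequence of the following operations: transferring all the data across a bijection $I\cong I'$ of index sets; and, for some $i\in I$ and $m\in\mathbb{Z}^n$, adding $m$ to each element of $E_{ij}$ and $-m$ to each element of $E_{ji}$ for all $j$. ''Can be recovered up to equivalence from'' given data means: the equivalence class of the discrete information is determined by that data (two such sequences, with points distinct modulo $\mathbb{Z}^n$, having the same such data have equivalent discrete information). *)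

(* Defs.v *)
From HB Require Import structures.
From Stdlib Require Import Relation_Operators.
From mathcomp Require Import all_boot all_order all_algebra.
From mathcomp Require Import generic_quotient ring_quotient.
From mathcomp Require Import finmap.
From mathcomp Require Import complex.
From mathcomp Require Import boolp classical_sets reals.
From mathcomp.multinomials Require Import xfinmap monalg.

Set Implicit Arguments.
Unset Strict Implicit.
Unset Printing Implicit Defensive.

Import Order.TTheory GRing.Theory Num.Theory.

Local Open Scope quotient_scope.
Local Open Scope classical_set_scope.
Local Open Scope ring_scope.

(* [laurent K n] is the group algebra K[Z^n]: [monalg] only provides the
   product when the monomials have no nontrivial invertible elements, which
   fails for Z^n. *)
Definition laurent (K : comNzRingType) (n : nat) : Type :=
  {malg K['rV[int]_n]}.

HB.instance Definition _ (K : comNzRingType) n :=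
  GRing.Zmodule.copy (laurent K n) {malg K['rV[int]_n]}.

Section LaurentRing.
Local Open Scope fset_scope.
Local Open Scope ring_scope.
Variables (K : comNzRingType) (n : nat).
Implicit Types (g : laurent K n) (k : 'rV[int]_n).

(* the monomial z^m *)
Definition lmon (m : 'rV[int]_n) : laurent K n := << 1 *g m >>.

Definition lone : laurent K n := lmon 0.

Definition lmul g1 g2 : laurent K n :=
  \sum_(k1 <- msupp g1) \sum_(k2 <- msupp g2)
    << g1@_k1 * g2@_k2 *g k1 + k2 >>.

Lemma lmulw (d1 d2 : {fset 'rV[int]_n}) g1 g2 :
  msupp g1 `<=` d1 -> msupp g2 `<=` d2 ->
  lmul g1 g2 = \sum_(k1 <- d1) \sum_(k2 <- d2) << g1@_k1 * g2@_k2 *g k1 + k2 >>.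
Proof.
move=> le_d1 le_d2; rewrite /lmul (big_fset_incl _ le_d1) /=.
  apply/eq_bigr=> k1 _; apply/big_fset_incl => // k _ /mcoeff_outdom ->.
  by rewrite mulr0 monalgU0.
move=> k _ /mcoeff_outdom g1k.
by rewrite big1 => // k' _; rewrite g1k mul0r monalgU0.
Qed.

Lemma lmulC : commutative lmul.
Proof.
move=> g1 g2; rewrite /lmul exchange_big /=.
by apply/eq_bigr=> k1 _; apply/eq_bigr=> k2 _; rewrite mulrC addrC.
Qed.

Lemma lmul0g : left_zero 0 lmul.
Proof. by move=> g; rewrite /lmul msupp0 big_seq_fset0. Qed.

Lemma lmulUU c1 c2 k1 k2 :
  lmul << c1 *g k1 >> << c2 *g k2 >> = << c1 * c2 *g k1 + k2 >>.
Proof. by rewrite (lmulw msuppU_le msuppU_le) !big_seq_fset1 !mcoeffUU. Qed.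

Lemma lmul1g : left_id lone lmul.
Proof.
move=> g; rewrite (lmulw msuppU_le (fsubset_refl _)) big_seq_fset1.
rewrite [RHS]monalgE; apply/eq_bigr => k _.
by rewrite mcoeffUU mul1r add0r.
Qed.

Lemma lmulDl : left_distributive lmul +%R.
Proof.
move=> g1 g2 g.
rewrite (lmulw (fsubsetUl (msupp g1) (msupp g2)) (fsubset_refl _)).
rewrite (lmulw (fsubsetUr (msupp g1) (msupp g2)) (fsubset_refl _)).
rewrite (lmulw (msuppD_le _ _) (fsubset_refl _)).
rewrite -big_split /=; apply/eq_bigr=> k1 _.
rewrite -big_split /=; apply/eq_bigr=> k2 _.
by rewrite mcoeffD mulrDl monalgUD.
Qed.

Lemma lmulDr : right_distributive lmul +%R.
Proof. by move=> g g1 g2; rewrite lmulC lmulDl !(lmulC g). Qed.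

Lemma lmul_suml (I : Type) (r : seq I) (f : I -> laurent K n) g :
  lmul (\sum_(i <- r) f i) g = \sum_(i <- r) lmul (f i) g.
Proof. exact: (big_morph (lmul^~ g) (fun _ _ => lmulDl _ _ _) (lmul0g _)). Qed.

Lemma lmul_sumr (I : Type) (r : seq I) (f : I -> laurent K n) g :
  lmul g (\sum_(i <- r) f i) = \sum_(i <- r) lmul g (f i).
Proof. by rewrite lmulC lmul_suml; apply/eq_bigr => i _; rewrite lmulC. Qed.

Lemma lmulE g1 g2 :
  lmul g1 g2 = \sum_(k <- msupp g1) lmul << g1@_k *g k >> g2.
Proof. by rewrite -lmul_suml -monalgE. Qed.

Lemma lmulA : associative lmul.
Proof.
move=> g1 g2 g3; rewrite (lmulE g1) (lmulE g1 g2) lmul_suml.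
apply: eq_bigr => k1 _; set u := << _ *g k1 >>.
rewrite (lmulE g2) lmul_sumr (lmulC u g2) (lmulE g2 u) lmul_suml.
apply: eq_bigr => k2 _; rewrite (lmulC _ u); set v := << _ *g k2 >>.
rewrite ![lmul _ g3]lmulC (lmulE g3 v) (lmulE g3 (lmul _ _)) lmul_sumr.
apply: eq_bigr => k3 _; rewrite /u /v !lmulUU.
by rewrite addrCA mulrCA.
Qed.

Lemma lone_neq0 : lone != 0.
Proof. by rewrite monalgU_eq0 oner_eq0. Qed.

HB.instance Definition _ := GRing.Zmodule_isComNzRing.Build (laurent K n)
  lmulA lmulC lmul1g lmulDl lone_neq0.

Lemma lmonD m1 m2 : lmon (m1 + m2) = lmon m1 * lmon m2.
Proof. by rewrite -[RHS]/(lmul _ _) lmulUU mulr1. Qed.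

End LaurentRing.

Section BasedSequences.
Variables (R : realType) (n : nat).

Local Notation Rn := (laurent R[i] n).

(* The isomorphism with the free module is [bs_coord], with inverse
   [bs_vec]. *)
Record based_seq := BasedSeq {
  bs_mod : int -> lmodType Rn;
  bs_diff : forall k, {linear bs_mod k -> bs_mod (k + 1)};
  bs_idx : int -> finType;
  bs_coord : forall k, {linear bs_mod k -> {ffun bs_idx k -> Rn^o}};
  bs_vec : forall k, {ffun bs_idx k -> Rn^o} -> bs_mod k;
  bs_coordK : forall k, cancel (@bs_coord k) (@bs_vec k);
  bs_vecK : forall k, cancel (@bs_vec k) (@bs_coord k);
  bs_bounded : exists N : nat, forall k : int, (N < `|k|)%N ->
    forall v : bs_mod k, v = 0;
  bs_mod0 : exists v : bs_mod 0, v != 0;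
  bs_mod_gt0 : forall k : int, 0 < k -> forall v : bs_mod k, v = 0
}.

Definition bs_I (F : based_seq) := {k : int & bs_idx F k}.

Variable F : based_seq.

Definition bs_deg (i : bs_I F) : int := tag i.

Definition bs_basis (k : int) (j : bs_idx F k) : bs_mod F k :=
  bs_vec [ffun j' => (j' == j)%:R].

(* The matrix entry d_ij; [untag] makes it 0 unless deg i = deg j + 1. *)
Definition entry (i j : bs_I F) : Rn :=
  untag 0
    (fun i' : bs_idx F (bs_deg j + 1) =>
       bs_coord F _ (bs_diff F (bs_deg j) (bs_basis (tagged j))) i') i.

Lemma entryE (k : int) (i : bs_idx F (k + 1)) (j : bs_idx F k) :
  entry (Tagged (bs_idx F) i) (Tagged (bs_idx F) j) =
  bs_coord F _ (bs_diff F k (bs_basis j)) i.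
Proof.
rewrite /entry (untagE _ _ (erefl : tag (Tagged (bs_idx F) i) = k + 1)).
by rewrite /etagged /=.
Qed.

Definition exponents (i j : bs_I F) : set 'rV[int]_n :=
  [set m | (entry i j)@_m != 0].

(* In the last case k > 1 and c is the chain j = i_0, i_1, ..., i_k = i;
   consecutive degrees differ by 1, so the sets E along it are given by
   [exponents]. *)
Definition expset (i j : bs_I F) : set 'rV[int]_n :=
  if bs_deg i <= bs_deg j then set0
  else if bs_deg i == bs_deg j + 1 then exponents i j
  else [set m | exists k : nat, bs_deg i = bs_deg j + k%:Z /\
    exists (c : 'I_k.+1 -> bs_I F) (p : 'I_k -> 'rV[int]_n),
      [/\ c ord0 = j, c ord_max = i,
          forall l : 'I_k.+1, bs_deg (c l) = bs_deg j + (l : nat)%:Z,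
          forall l : 'I_k,
            exponents (c (lift ord0 l)) (c (widen_ord (leqnSn k) l)) (p l)
        & m = \sum_(l < k) p l]].

End BasedSequences.

Section Simplices.
Variables (R : realType) (n : nat).

Definition Zlattice : {pred 'rV[R]_n} :=
  [pred v : 'rV[R]_n | [forall j, v 0 j \is a Num.int]].

Fact Zlattice_zmod_closed : zmod_closed Zlattice.
Proof.
split=> [|u v]; rewrite !inE; first by apply/forallP => j; rewrite mxE rpred0.
move=> /forallP uZ /forallP vZ; apply/forallP => j.
by rewrite !mxE rpredB.
Qed.

HB.instance Definition _ :=
  GRing.isZmodClosed.Build 'rV[R]_n Zlattice Zlattice_zmod_closed.

Definition torus := Quotient.quot Zlattice.

Definition torus_pi (v : 'rV[R]_n) : torus := \pi_torus v.

Lemma torus_piP (u v : 'rV[R]_n) :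
  torus_pi u = torus_pi v <-> exists m : 'rV[int]_n, u = v + map_mx intr m.
Proof.
split=> [/eqP|[m ->]].
  rewrite /torus_pi -Quotient.idealrBE => /forallP uv.
  exists (\row_j Num.floor ((u - v) 0 j)); apply/rowP => j.
  have /floorK := uv j.
  by rewrite !mxE => ->; rewrite addrC subrK.
apply/eqP; rewrite -Quotient.idealrBE addrAC subrr add0r.
by apply/forallP => j; rewrite mxE intr_int.
Qed.

Definition std_simplex (k : nat) :=
  {t : 'rV[R]_k.+1 | [forall l, 0 <= t 0 l] && (\sum_l t 0 l == 1)}.

Definition simplex (k : nat) := std_simplex k -> torus.

(* [y_0, ..., y_k] mod Z^n *)
Definition simplex_mod (k : nat) (y : k.+1.-tuple 'rV[R]_n) : simplex k :=
  fun t => torus_pi (\sum_l sval t 0 l *: tnth y l).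

Lemma simplex_mod0E (y : 1.-tuple 'rV[R]_n) t :
  simplex_mod y t = torus_pi (tnth y ord0).
Proof.
case: t => t t1; rewrite /simplex_mod /= big_ord1.
have /andP[_] := t1; rewrite big_ord1 => /eqP ->.
by rewrite scale1r.
Qed.

Fact std_simplex0_subproof :
  [forall l, 0 <= (const_mx 1 : 'rV[R]_1) 0 l] &&
  (\sum_l (const_mx 1 : 'rV[R]_1) 0 l == 1).
Proof. by rewrite big_ord1 mxE eqxx andbT; apply/forallP => l; rewrite mxE. Qed.

Lemma simplex_mod0_inj (u v : 'rV[R]_n) :
  simplex_mod [tuple u] = simplex_mod [tuple v] -> torus_pi u = torus_pi v.
Proof.
have t0 : std_simplex 0 by exists (const_mx 1); exact: std_simplex0_subproof.
move=> /(congr1 (fun s : simplex 0 => s t0)).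
by rewrite !simplex_mod0E.
Qed.

Definition distinct_mod (I : Type) (x : I -> 'rV[R]_n) :=
  injective (torus_pi \o x).

Variables (F : based_seq R n) (x : bs_I F -> 'rV[R]_n).

Definition XF (k : nat) : set (simplex k) :=
  [set s | exists (c : 'I_k.+1 -> bs_I F) (p : 'I_k -> 'rV[int]_n),
    (forall l : 'I_k,
       expset (c (lift ord0 l)) (c (widen_ord (leqnSn k) l)) (p l)) /\
    s = simplex_mod
      [tuple x (c l) + map_mx intr (\sum_(l' < k | (l' < l)%N) p l')
      | l < k.+1]].

Arguments XF : clear implicits.

(* deg on X_0, with the value 0 outside of X_0 *)
Definition XF_deg (s : simplex 0) : int :=
  if pselect (exists i, simplex_mod [tuple x i] = s) is left h
  then bs_deg (projT1 (cid h)) else 0.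

Lemma XF_degE : distinct_mod x ->
  forall i, XF_deg (simplex_mod [tuple x i]) = bs_deg i.
Proof.
move=> x_inj i; rewrite /XF_deg; case: pselect => [h|]; last by case; exists i.
by case: (cid h) => j /= /simplex_mod0_inj /x_inj ->.
Qed.

Lemma XF0E : XF 0 = [set simplex_mod [tuple x i] | i in [set: bs_I F]].
Proof.
apply/seteqP; split=> s.
  move=> [c [p [_ ->]]]; exists (c ord0) => //.
  apply/funext => t; rewrite !simplex_mod0E tnth_mktuple big_ord0 raddf0.
  by rewrite addr0.
move=> [i _ <-]; exists (fun=> i), (fun=> 0); split=> [[]//|].
apply/funext => t; rewrite !simplex_mod0E tnth_mktuple big_ord0 raddf0.
by rewrite addr0.
Qed.

End Simplices.

Arguments XF {R n F} x k _.

Section DiscreteInformation.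
Variable n : nat.

Record dinfo := DInfo {
  di_idx : eqType;
  di_deg : di_idx -> int;
  di_E : di_idx -> di_idx -> set 'rV[int]_n
}.

(* For a = b = i both translations apply and cancel out. *)
Definition di_shift (D : dinfo) (i : di_idx D) (m : 'rV[int]_n) : dinfo :=
  DInfo (@di_deg D) (fun a b =>
    [set p + m *+ (a == i) - m *+ (b == i) | p in di_E a b]).

Inductive di_step : dinfo -> dinfo -> Prop :=
| di_step_transfer (D D' : dinfo) (f : di_idx D -> di_idx D') :
    bijective f -> (forall i, di_deg (f i) = di_deg i) ->
    (forall i j, di_E (f i) (f j) = di_E i j) -> di_step D D'
| di_step_shift (D : dinfo) (i : di_idx D) (m : 'rV[int]_n) :
    di_step D (di_shift i m).

Definition di_equiv : dinfo -> dinfo -> Prop := clos_refl_trans dinfo di_step.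

End DiscreteInformation.

Definition discrete_info (R : realType) (n : nat) (F : based_seq R n) :
  dinfo n := DInfo (@bs_deg R n F) (@expset R n F).

(* Main.v *)
Require Import Defs.
From Stdlib Require Import Relation_Operators.
From mathcomp Require Import all_boot all_order all_algebra ring.
From mathcomp Require Import boolp classical_sets reals.

Set Implicit Arguments.
Unset Strict Implicit.
Unset Printing Implicit Defensive.

Import Order.TTheory GRing.Theory Num.Theory.

Local Open Scope classical_set_scope.
Local Open Scope ring_scope.

(** Two affine edges in [R^n] have the same image in [T^n] iff they differ by a
    lattice translation, because their difference is a continuous lattice-valued
    function. As the [x i] are distinct modulo [Z^n], an edge [[x j, x i + m]]
    mod [Z^n] thus remembers [j], [i] and [m]. For the recovery statement,
    equality of the 0-simplices gives a bijection [f] of the index sets with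
    [x' (f i) = x i + a i] for lattice vectors [a i]; the first part then gives
    [E' (f i) (f j) = E i j - a i + a j], which is reached from [E] by one
    translation for each of the finitely many indices. *)

Section Edges.
Variables (R : realType) (n : nat).
Implicit Types (u v : 'rV[R]_n) (a b : 'rV[int]_n).

Local Notation toR := (map_mx (intr : int -> R)).

Lemma map_intr_inj a b : toR a = toR b -> a = b.
Proof.
move=> /rowP ab; apply/rowP => k.
by have /intr_inj := etrans (esym (mxE _ _ _ _)) (etrans (ab k) (mxE _ _ _ _)).
Qed.

Fact edge_point_subproof (t : R) : 0 <= t <= 1 ->
  [forall l, 0 <= (\row_(l < 2) (if l == 0 then 1 - t else t)) 0 l] &&
  (\sum_l (\row_(l < 2) (if l == 0 then 1 - t else t)) 0 l == 1).
Proof.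
move=> /andP[t0 t1]; apply/andP; split.
  by apply/forallP => l; rewrite mxE; case: ifP => // _; rewrite subr_ge0.
by rewrite !big_ord_recl big_ord0 !mxE /= addr0 subrK.
Qed.

Definition edge_point (t : R) (t01 : 0 <= t <= 1) : std_simplex R 1 :=
  exist _ (\row_(l < 2) (if l == 0 then 1 - t else t))
    (edge_point_subproof t01).

Lemma simplex_mod_edge u v t (t01 : 0 <= t <= 1) :
  simplex_mod [tuple u; v] (edge_point t01) =
  torus_pi ((1 - t) *: u + t *: v).
Proof.
by rewrite /simplex_mod /= !big_ord_recl big_ord0 !mxE /= addr0.
Qed.

Lemma eq_int_segment (p q : int) :
  (forall t : R, 0 <= t <= 1 ->
     exists c : int, (1 - t) * p%:~R + t * q%:~R = c%:~R) -> p = q.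
Proof.
(* At [t = 1 / N] the value differs from [p] by less than [1]. *)
pose N : nat := `|(q - p)%R|%N.+1.
have N0 : (0 : R) < N%:R by rewrite ltr0n.
have N01 : 0 <= (N%:R : R)^-1 <= 1.
  by rewrite invr_ge0 ltW //= invf_le1 // ler1n.
move=> /(_ _ N01)[c cE].
have cN : (c - p) * N%:Z = q - p.
  apply: (@intr_inj R); rewrite intrM !intrB -cE -pmulrn.
  by field; rewrite gt_eqF.
have := congr1 absz cN; rewrite abszM absz_nat -/N => kN.
case: (posnP `|(c - p)%R|%N) => [/eqP|k0].
  rewrite absz_eq0 => /eqP cp; move: cN; rewrite cp mul0r => /esym/eqP.
  by rewrite subr_eq0 => /eqP.
by have := leq_pmull N k0; rewrite kN ltnn.
Qed.

Lemma simplex_mod1P u v u' v' :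
  simplex_mod [tuple u; v] = simplex_mod [tuple u'; v'] <->
  exists a, u = u' + toR a /\ v = v' + toR a.
Proof.
split=> [uv|[a [-> ->]]]; last first.
  apply/funext => -[t t1]; have /andP[_ /eqP] := t1.
  rewrite /simplex_mod /= !big_ord_recl !big_ord0 /= !addr0 => ts.
  apply/torus_piP; exists a.
  by rewrite !scalerDr addrACA -scalerDl ts scale1r.
(* The translation [c] obtained pointwise may depend on [t]; the endpoints give [a] and [b]. *)
have uvE t : 0 <= t <= 1 -> exists c,
    (1 - t) *: u + t *: v = (1 - t) *: u' + t *: v' + toR c.
  move=> t01; apply/torus_piP.
  by rewrite -!(simplex_mod_edge _ _ t01) uv.
have [a] := uvE 0 ltac:(by rewrite lexx ler01).
rewrite subr0 !scale1r !scale0r !addr0 => uE.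
have [b] := uvE 1 ltac:(by rewrite lexx ler01).
rewrite subrr !scale1r !scale0r !add0r => vE.
exists a; split=> //; rewrite vE; congr (_ + toR _).
(* The difference of the two lifts at [t] is [(1 - t) a + t b]; being integral for every [t], each
   coordinate is constant, so [a = b]. *)
apply/esym/rowP => k; apply: eq_int_segment => t /uvE[c].
rewrite uE vE !scalerDr addrACA => /addrI/rowP/(_ k).
by rewrite !mxE => ->; exists (c 0 k).
Qed.

End Edges.

Section ExpsetRecovery.
Variables (R : realType) (n : nat) (F : based_seq R n).
Variable x : bs_I F -> 'rV[R]_n.

Lemma XF1E s : XF x 1 s <-> exists i j m,
  expset i j m /\ s = simplex_mod [tuple x j; x i + map_mx intr m].
Proof.
(* The partial sum of translations is empty at vertex 0 and equals [p ord0] at vertex 1. *)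
have sE (c : 'I_2 -> bs_I F) (p : 'I_1 -> 'rV[int]_n) :
    [tuple x (c l) + map_mx intr (\sum_(l' < 1 | (l' < l)%N) p l') | l < 2] =
    [tuple x (c ord0); x (c (lift ord0 ord0)) + map_mx intr (p ord0)].
  apply: eq_from_tnth => l; rewrite tnth_mktuple big_mkcond big_ord1.
  case: (unliftP ord0 l) => [l'|] -> /=; last first.
    by rewrite raddf0 addr0 (tnth_nth 0).
  by rewrite ord1 (tnth_nth 0).
split=> [[c [p [cp ->]]]|[i [j [m [ijm ->]]]]].
  exists (c (lift ord0 ord0)), (c ord0), (p ord0); split; last by rewrite sE.
  suff -> : ord0 = widen_ord (leqnSn 1) ord0 by exact: cp.
  exact: val_inj.
exists (fun l => if l == ord0 then j else i), (fun=> m).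
by split=> [l|]; [rewrite ord1 | rewrite sE].
Qed.

Lemma expsetE : distinct_mod x -> forall i j, expset i j =
  [set m | XF x 1 (simplex_mod [tuple x j; x i + map_mx intr m])].
Proof.
move=> x_inj i j; apply/seteqP; split=> m /=.
  by move=> ijm; apply/XF1E; exists i, j, m.
move=> /XF1E[i' [j' [m' [E' /simplex_mod1P[a [ja im]]]]]].
have jj : j = j' by apply/x_inj/torus_piP; exists a.
have ii : i = i'.
  apply/x_inj/torus_piP; exists (m' + a - m).
  by rewrite raddfB raddfD /= !addrA -im addrK.
(* Once the initial vertices agree, the common translation [a] is zero, and the terminal vertices
   then give [m = m']. *)
move: ja im; rewrite jj ii -[LHS]addr0 => /addrI a0.
by rewrite -a0 addr0 => /addrI/map_intr_inj ->.
Qed.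

(** Boundedness leaves only the degrees from [-N] to [N]: elsewhere the module is zero, whereas a
    basis vector has a coordinate equal to 1. *)
Lemma bs_I_finite : exists s : seq (bs_I F), forall i, i \in s.
Proof.
have [N F0] := bs_bounded F.
pose ks : seq int := [seq (k%:Z - N%:Z)%R | k <- iota 0 (N + N).+1].
exists [seq Tagged (bs_idx F) i | k <- ks, i <- enum (bs_idx F k)].
move=> [k i]; apply/allpairsPdep; exists k, i; split=> //; last first.
  by rewrite mem_enum.
have kN : (`|k| <= N)%N.
  rewrite leqNgt; apply/negP => /F0 /(_ (bs_basis i)).
  move=> /(congr1 (bs_coord F k)); rewrite bs_vecK raddf0.
  move=> /ffunP/(_ i); rewrite !ffunE eqxx => /eqP.
  by rewrite oner_eq0.
have kN' : 0 <= k + N%:Z.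
  rewrite -lerBlDr sub0r lerNl (le_trans (ler_norm _)) //.
  by rewrite normrN -abszE lez_nat.
apply/mapP; exists `|(k + N%:Z)%R|%N; last by rewrite gez0_abs // addrK.
rewrite mem_iota /= add0n ltnS -lez_nat gez0_abs // PoszD lerD2r.
by rewrite (le_trans (ler_norm _)) // -abszE lez_nat.
Qed.

End ExpsetRecovery.

(** Induction on [s], with one [di_shift] for each new index; uniqueness ensures that no index is
    translated twice. *)
Lemma di_equiv_shifts n (D : dinfo n) (a : di_idx D -> 'rV[int]_n) s :
  uniq s ->
  di_equiv D (DInfo (@di_deg _ D) (fun p q =>
    [set m + a p *+ (p \in s) - a q *+ (q \in s) | m in di_E p q])).
Proof.
elim: s => [_|i s IHs /= /andP[i_s /IHs{}IHs]].
  suff <- : D = DInfo (@di_deg _ D) (fun p q =>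
      [set m + a p *+ (p \in [::]) - a q *+ (q \in [::]) | m in di_E p q]).
    exact: rt_refl.
  case: D a => I d E a /=; congr DInfo; apply/funext => p; apply/funext => q.
  by under eq_imagel do rewrite !mulr0n addr0 subr0; rewrite image_id.
apply: rt_trans IHs _; set D' := DInfo _ _.
suff -> : DInfo (@di_deg _ D) (fun p q =>
    [set m + a p *+ (p \in i :: s) - a q *+ (q \in i :: s) | m in di_E p q])
  = @di_shift n D' i (a i) by exact/rt_step/di_step_shift.
rewrite /di_shift /=; congr DInfo; apply/funext => p; apply/funext => q.
(* As [i] is not in [s], the two multiplicities on the right are never both 1. *)
have aE r : a r *+ (r \in i :: s) = a r *+ (r \in s) + a i *+ (r == i).
  rewrite inE; case: eqVneq => [->|_] /=; last by rewrite addr0.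
  by rewrite (negPf i_s) add0r.
rewrite image_comp; apply: eq_imagel => m _ /=.
by rewrite !aE opprD !addrA; congr (_ - _); rewrite addrAC.
Qed.

Theorem theorem3p5 (R : realType) (n : nat) (F : based_seq R n)
    (x : bs_I F -> 'rV[R]_n) (hx : distinct_mod x) :
  (forall i j : bs_I F,
     expset i j = [set m : 'rV[int]_n |
       XF x 1 (simplex_mod [tuple x j; x i + map_mx intr m])]) /\
  (forall (F' : based_seq R n) (x' : bs_I F' -> 'rV[R]_n),
     distinct_mod x' ->
     (forall k : nat, XF x k = XF x' k) ->
     {in XF x 0, XF_deg x =1 XF_deg x'} ->
     di_equiv (discrete_info F) (discrete_info F')).
Proof.
split=> [|F' x' hx' XFF' degE]; first exact: expsetE.
have vtx i : exists i', simplex_mod [tuple x' i'] = simplex_mod [tuple x i].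
  have : XF x 0 (simplex_mod [tuple x i]) by rewrite XF0E; exists i.
  by rewrite XFF' XF0E => -[i' _ <-]; exists i'.
have vtx' i' : exists i, simplex_mod [tuple x i] = simplex_mod [tuple x' i'].
  have : XF x' 0 (simplex_mod [tuple x' i']) by rewrite XF0E; exists i'.
  by rewrite -XFF' XF0E => -[i _ <-]; exists i.
have [f fE] := choice vtx; have [g gE] := choice vtx'.
have f_bij : bijective f.
  exists g => i.
    by apply/hx/simplex_mod0_inj; rewrite gE fE.
  by apply/hx'/simplex_mod0_inj; rewrite fE gE.
have f_deg i : bs_deg (f i) = bs_deg i.
  rewrite -(XF_degE hx') -(XF_degE hx) fE degE // mem_set // XF0E.
  by exists i.
have /choice[a aE] i : exists a, x' (f i) = x i + map_mx intr a.
  exact/torus_piP/simplex_mod0_inj.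
have [s sI] := bs_I_finite F.
(* Moving the vertex [x i] by [a i] lowers the exponents towards [i] by [a i], hence the sign;
   afterwards [f] transfers the data unchanged. *)
apply: rt_trans (@di_equiv_shifts n (discrete_info F) (fun i => - a i)
  (undup s) (undup_uniq s)) _; apply: rt_step.
set D := (X in di_step X _).
apply: (@di_step_transfer n D (discrete_info F') f) => //= i j.
rewrite (expsetE hx') -XFF'; apply/seteqP; split=> m /=.
  move=> XFm; exists (m + a i - a j); last first.
    by rewrite !mem_undup !sI !mulr1n opprK addrAC subrK addrK.
  rewrite (expsetE hx) /=.
  suff -> : simplex_mod [tuple x j; x i + map_mx intr (m + a i - a j)] =
    simplex_mod [tuple x' (f j); x' (f i) + map_mx intr m] by [].
  (* Translating by [- a j] brings the initial vertex [x' (f j)] back to [x j]. *)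
  apply/simplex_mod1P; exists (- a j).
  by rewrite !aE !raddfB !raddfD !raddfN /= addrK !addrA (addrAC (x i)).
move=> [m' + <-]; rewrite (expsetE hx) /=.
rewrite !mem_undup !sI !mulr1n opprK => XFm.
suff -> : simplex_mod [tuple x' (f j); x' (f i) + map_mx intr (m' - a i + a j)]
  = simplex_mod [tuple x j; x i + map_mx intr m'] by [].
apply/simplex_mod1P; exists (a j).
by rewrite !aE !raddfD !raddfN /= !addrA (addrAC (x i)) addrK.
Qed.
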